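(* For all integers $w\geq 4$ and $k\geq 1$, we have $$k^{w-1}\leq f(k,w)\leq\min\left\{k^w-k^2(k-1)^{w-2},\ \left\lceil\tfrac{w}{3}\right\rceil k^{w-1}\right\}.$$
   Context: Vectors are elements of $\mathbb{Z}^w$; $A[i]$ denotes the $i$th coordinate of $A\in\mathbb{Z}^w$, $1\leq i\leq w$. For $A,B\in\mathbb{Z}^w$, $A\leq B$ means $A[i]\leq B[i]$ for every coordinate $i$ (product order); antichains in $\mathbb{Z}^w$ are with respect to this order. For an integer $k\geq 1$, vectors $A,B\in\mathbb{Z}^w$ are $k$-crossing if there are coordinates $i$ and $j$ with $A[i]-B[i]\geq k$ and $B[j]-A[j]\geq k$. (Thus a family is an antichain if and only if any two distinct members are $1$-crossing.) A family of vectors is $k$-crossing-free if it contains no two $k$-crossing vectors. For positive integers $k,w$, $f(k,w)$ denotes the maximum size of a $k$-crossing-free antichain in $\mathbb{Z}^w$. *)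

(* Defs.v *)
From mathcomp Require Import all_boot all_order all_algebra.
From mathcomp Require Import classical_sets functions cardinality.

Set Implicit Arguments.
Unset Strict Implicit.
Unset Printing Implicit Defensive.

Import Order.TTheory GRing.Theory Num.Theory.
Local Open Scope ring_scope.
Local Open Scope classical_set_scope.
Local Open Scope card_scope.

Definition vec_le (w : nat) (A B : 'rV[int]_w) : Prop :=
  forall i : 'I_w, A 0 i <= B 0 i.

Definition antichain (w : nat) (F : set 'rV[int]_w) : Prop :=
  forall A B : 'rV[int]_w, F A -> F B -> A <> B -> ~ vec_le A B.

Definition crossing (k w : nat) (A B : 'rV[int]_w) : Prop :=
  exists i j : 'I_w,
    k%:Z <= A 0 i - B 0 i /\ k%:Z <= B 0 j - A 0 j.

Definition crossing_free (k w : nat) (F : set 'rV[int]_w) : Prop :=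
  forall A B : 'rV[int]_w, F A -> F B -> ~ crossing k A B.

(* [is_f k w m] is the graph of the partial function f: f(k,w) exists and
   equals m.  The upper bound ranges over all families, infinite ones
   included, so it also says that every such family is finite. *)
Definition is_f (k w m : nat) : Prop :=
  (exists F : set 'rV[int]_w,
      [/\ antichain F, crossing_free k F & F #= `I_m]) /\
  (forall F : set 'rV[int]_w,
      antichain F -> crossing_free k F -> F #<= `I_m).

(* Main.v *)
(* A k-crossing-free antichain in Z^(a+b) is split according to the residues mod k
   of the first a coordinates.  Two members with the same residues that differ in
   a coordinate differ there by at least k, so crossing-freeness makes such a
   class a chain on these coordinates.  Removing from each class the members
   that are extremal in the last b coordinates leaves, for each residue of the
   last b coordinates, an antichain on the first a ones; this gives
   f(a+b) <= k^a f(b) + k^b f(a).  For b = 1, colouring the remaining members by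
   the last coordinate mod k-1 instead of k gives f(a+1) <= k^a + (k-1) f(a).

   With f(1) = 1 and f(2) <= k, both upper bounds then reduce to f(3) <= k^2.
   There, keep the coordinates x, y and replace the third one by a nonnegative
   potential v of minimal sum.  A level of v is a staircase in the (x, y)-plane;
   minimality forces any nonempty level n >= k to lie below level n-k at some
   place by at least k in l^1-distance, while by crossing-freeness level n lies
   nowhere k or more below or to the left of level n-k.  Adding up these
   constraints, all the levels congruent to n mod k have together at most k
   members.

   The lower bound is attained by the vectors of sum 0 with all coordinates but
   one in [0, k-1]. *)
Require Import Defs.
From mathcomp Require Import all_boot all_order all_algebra.
From mathcomp Require Import classical_sets functions cardinality.
From mathcomp Require Import boolp zify ring.

Set Implicit Arguments.
Unset Strict Implicit.
Unset Printing Implicit Defensive.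

Import Order.TTheory GRing.Theory Num.Theory.
Local Open Scope ring_scope.

(** * Indexed families and residue classes *)

Definition good (k : nat) (I : Type) (T : finType) (D : {set T})
    (a : T -> I -> int) : Prop :=
  (forall s t, s \in D -> t \in D -> s != t -> exists i, a t i < a s i) /\
  (forall s t i j, s \in D -> t \in D ->
     k%:Z <= a s i - a t i -> k%:Z <= a t j - a s j -> False).

Definition at_most (k : nat) (I : Type) (m : nat) : Prop :=
  forall (T : finType) (D : {set T}) (a : T -> I -> int),
    good k D a -> (#|D| <= m)%N.

Lemma card_le_fibers (T R : finType) (D : {set T}) (f : T -> R) (m : nat) :
  (forall r, #|[set t in D | f t == r]| <= m)%N -> (#|D| <= #|R| * m)%N.
Proof.
move=> Hm; rewrite -sum1_card (partition_big f xpredT) //= -sum_nat_const.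
apply: leq_sum => r _; apply: leq_trans (Hm r).
by rewrite -sum1_card; apply/eq_leq/eq_bigl => t; rewrite inE.
Qed.

Lemma residueP (k : nat) : (0 < k)%N ->
  exists r : int -> 'I_k, forall x y, r x = r y -> y < x -> y + k%:Z <= x.
Proof.
move=> k0.
have lt_r x : (`|(x %% k)%Z| < k)%N.
  have := ltz_pmod x (_ : 0 < k%:Z); have := modz_ge0 x (_ : k%:Z != 0); lia.
exists (fun x => Ordinal (lt_r x)) => x y /(congr1 val) /= e lt_yx.
have exy : (x %% k)%Z = (y %% k)%Z.
  have := modz_ge0 x (_ : k%:Z != 0); have := modz_ge0 y (_ : k%:Z != 0); lia.
have ex := divz_eq x k; have ey := divz_eq y k; rewrite exy in ex.
have lt_q : (y %/ k)%Z < (x %/ k)%Z.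
  rewrite ltNge; apply/negP => le_q.
  have := ler_wpM2r (_ : 0 <= k%:Z) le_q; lia.
have := ler_wpM2r (_ : 0 <= k%:Z) (_ : (y %/ k)%Z + 1 <= (x %/ k)%Z).
by rewrite mulrDl mul1r; lia.
Qed.

(** * Recursive bounds in the dimension *)

(** A [bad] member dominates another member of its [r1]-class on the last b coordinates. The
    remaining members form an antichain there in each [r1]-class; the bad ones form an antichain on
    the first a coordinates in each [r2]-class. *)
Lemma at_most_add (k a b alpha beta : nat) : (0 < k)%N ->
  at_most k 'I_a alpha -> at_most k 'I_b beta ->
  at_most k 'I_(a + b) (k ^ a * beta + k ^ b * alpha).
Proof.
move=> k0 ha hb T D v [anti nocr].
have [r rP] := residueP k0.
pose r1 t := [ffun i : 'I_a => r (v t (lshift b i))].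
pose r2 t := [ffun j : 'I_b => r (v t (rshift a j))].
pose le2 s t := [forall j : 'I_b, v s (rshift a j) <= v t (rshift a j)].
pose bad t := [exists s in D, [&& s != t, r1 s == r1 t & le2 s t]].
have r1P s t i : r1 s = r1 t -> v t (lshift b i) < v s (lshift b i) ->
    v t (lshift b i) + k%:Z <= v s (lshift b i).
  by move=> /ffunP /(_ i); rewrite !ffunE; apply: rP.
have r2P s t j : r2 s = r2 t -> v t (rshift a j) < v s (rshift a j) ->
    v t (rshift a j) + k%:Z <= v s (rshift a j).
  by move=> /ffunP /(_ j); rewrite !ffunE; apply: rP.
have cardr n : #|{ffun 'I_n -> 'I_k}| = (k ^ n)%N by rewrite card_ffun !card_ord.
rewrite -(cardsID [set t | bad t] D) addnC leq_add //.
- rewrite -cardr; apply: (card_le_fibers (f := r1)) => q.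
  apply: (hb _ _ (fun t j => v t (rshift a j))); split=> [s t|s t i j].
    rewrite !inE => /andP[/andP[nbs sD] /eqP <-] /andP[/andP[nbt tD] et] nst.
    case: (boolP (le2 s t)) => [le_st|]; last first.
      by case/forallPn=> j; rewrite -ltNge; exists j.
    case/negP: nbt; apply/existsP; exists s.
    by rewrite sD nst eq_sym et.
  rewrite !inE => /andP[/andP[_ sD] _] /andP[/andP[_ tD] _].
  exact: nocr.
- rewrite -cardr; apply: (card_le_fibers (f := r2)) => q.
  apply: (ha _ _ (fun t j => v t (lshift b j))); split=> [s t|s t i j]; last first.
    rewrite !inE => /andP[/andP[sD _] _] /andP[/andP[tD _] _].
    exact: nocr.
  rewrite !inE => /andP[/andP[sD bs] /eqP es] /andP[/andP[tD bt] /eqP et] nst.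
  case: (boolP [exists i : 'I_a, v t (lshift b i) < v s (lshift b i)]).
    by case/existsP=> i; exists i.
  rewrite negb_exists => /forallP le_st; exfalso.
  have [i] := anti s t sD tD nst.
  case: (splitP i) => i' ei lti.
    have Ei : i = lshift b i' by apply: val_inj.
    by move: (le_st i'); rewrite -Ei lti.
  have Ei : i = rshift a i' by apply: val_inj.
  rewrite Ei in lti.
  have ltj := r2P s t i' (etrans es (esym et)) lti.
  (* [u] makes [t] bad. It exceeds [t], hence also [s], by at least k in one of the first a
     coordinates, while [s] exceeds [t], hence also [u], by at least k in one of the last b: [u] and
     [s] cross. *)
  case/existsP: bt => u /and4P[uD nut /eqP eu /forallP le_ut].
  have [m] := anti u t uD tD nut.
  case: (splitP m) => m' em ltm; last first.
    have Em : m = rshift a m' by apply: val_inj.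
    by move: (le_ut m'); rewrite -Em leNgt ltm.
  have Em : m = lshift b m' by apply: val_inj.
  rewrite Em in ltm.
  have ltm' := r1P u t m' eu ltm.
  move: (le_st m') (le_ut i'); rewrite -leNgt => h1 h2.
  apply: (nocr u s (lshift b m') (rshift a i') uD sD); lia.
Qed.

Lemma at_most_succ (k a alpha : nat) : (0 < k)%N ->
  at_most k 'I_a alpha -> at_most k 'I_(a + 1) (k ^ a + k.-1 * alpha).
Proof.
move=> k0 ha T D v [anti nocr].
have [r rP] := residueP k0.
pose x t (i : 'I_a) := v t (lshift 1 i); pose z t := v t (rshift a (ord0 : 'I_1)).
pose r1 t := [ffun i : 'I_a => r (x t i)].
pose wit t u := [&& u \in D, u != t, r1 u == r1 t & z t <= z u].
have r1P s t i : r1 s = r1 t -> x t i < x s i -> x t i + k%:Z <= x s i.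
  by move=> /ffunP /(_ i); rewrite !ffunE; apply: rP.
have antiE s t : s \in D -> t \in D -> s != t -> z t < z s \/ exists i, x t i < x s i.
  move=> sD tD nst; have [i] := anti s t sD tD nst.
  case: (splitP i) => i' ei lti.
    have Ei : i = lshift 1 i' by apply: val_inj.
    by right; exists i'; rewrite /x -Ei.
  have Ei : i = rshift a i' by apply: val_inj.
  by left; rewrite /z; move: lti; rewrite Ei (ord1 i').
(* Having equal residues, [t] exceeds [u] by at least k in some coordinate of [x]; crossing-freeness
   then keeps the rise of [z] below k. *)
have witP t u : t \in D -> wit t u ->
    z t < z u < z t + k%:Z /\ exists i, x u i + k%:Z <= x t i.
  move=> tD /and4P[uD nut /eqP eu le_tu].
  have [i lti] : exists i, x u i < x t i.
    case: (antiE t u tD uD); rewrite 1?eq_sym //.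
    by move=> lt; move: le_tu; rewrite leNgt lt.
  have lti' := r1P t u i (esym eu) lti.
  split; last by exists i.
  case: (ltP (z t) (z u)) => [ltz|lez].
    rewrite ltNge; apply/negP => h.
    by apply: (nocr t u (lshift 1 i) (rshift a ord0) tD uD); move: h lti'; rewrite /x /z; lia.
  case: (antiE u t uD tD nut) => [|[j ltj]]; first by rewrite ltNge lez.
  have ltj' := r1P u t j eu ltj.
  by case: (nocr t u (lshift 1 i) (lshift 1 j) tD uD); move: lti' ltj'; rewrite /x; lia.
have cardr : #|{ffun 'I_a -> 'I_k}| = (k ^ a)%N by rewrite card_ffun !card_ord.
rewrite -(cardsID [set t | [exists u, wit t u]] D) addnC leq_add //.
- rewrite -cardr -[X in (_ <= X)%N]muln1.
  apply: (card_le_fibers (f := r1)) => q.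
  apply/card_le1_eqP => s t.
  rewrite !inE => /andP[/andP[nws sD] /eqP es] /andP[/andP[nwt tD] /eqP et].
  apply/eqP; apply: contraT => nst.
  case: (leP (z t) (z s)) => [le_ts|/ltW le_st].
    by case/negP: nwt; apply/existsP; exists s; rewrite /wit sD eq_sym nst es et eqxx.
  by case/negP: nws; apply/existsP; exists t; rewrite /wit tD nst es et eqxx.
case: (posnP k.-1) => [k1|k1].
  rewrite k1 mul0n leqn0 cards_eq0; apply/eqP/setP => t; rewrite !inE.
  apply/negP => /andP[tD /existsP[u /witP]] /(_ tD) [h _].
  by move: h; lia.
have [r' r'P] := residueP k1.
rewrite -[X in (_ <= X * _)%N]card_ord; apply: (card_le_fibers (f := fun t => r' (z t))) => q.
apply: (ha _ _ x); split=> [s t|s t i j]; last first.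
  rewrite !inE => /andP[/andP[sD _] _] /andP[/andP[tD _] _].
  exact: nocr.
rewrite !inE => /andP[/andP[sD /existsP[u wu]] /eqP es] /andP[/andP[tD _] /eqP et] nst.
case: (boolP [exists i : 'I_a, x t i < x s i]); first by case/existsP=> i; exists i.
rewrite negb_exists => /forallP le_st; exfalso.
case: (antiE s t sD tD nst) => [ltz|[i lti]]; last by move: (le_st i); rewrite lti.
have gap := r'P _ _ (etrans es (esym et)) ltz.
(* The colouring only gives [z t + (k - 1) <= z s]. The witness [u] of [s] is strictly higher in
   [z], which supplies the missing unit: [t] and [u] cross. *)
have [lez [i gi]] := witP s u sD wu.
have /and4P[uD _ _ _] := wu.
move: (le_st i); rewrite -leNgt => h.
apply: (nocr t u (lshift 1 i) (rshift a ord0) tD uD); move: gap lez gi h; rewrite /x /z; lia.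
Qed.

(** * Counting on staircases in the plane *)

Lemma card_interval (T : finType) (S : {set T}) (g : T -> int) (lo hi : int) :
  {in S &, injective g} -> lo <= hi -> {in S, forall t, lo < g t <= hi} ->
  #|S|%:Z <= hi - lo.
Proof.
move=> injg le_lh gS; case: (posnP #|S|) => [->|/card_gt0P[t0 t0S]]; first by lia.
have := gS t0 t0S => lt0.
have [n En] : exists n : nat, hi - lo = n.+1%:Z.
  by exists `|hi - lo|.-1; lia.
rewrite En lez_nat -[n.+1]card_ord.
apply: (@leq_card_in _ _ (fun t => inord (`|g t - lo|.-1)%N)) => s t sS tS.
move=> /(congr1 val); have := gS s sS; have := gS t tS => lt ls.
rewrite /= !inordK; [|lia|lia] => e.
by apply: injg => //; lia.
Qed.

(** Positions on a staircase are expressed through such counts, which spares enumerating it in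
    order. *)
Definition above (T : finType) (N : {set T}) (g : T -> int) (b : int) : nat :=
  #|[set t in N | b < g t]|.

Lemma above_max (T : finType) (N : {set T}) (g : T -> int) (c b : int) :
  {in N &, injective g} -> b <= c -> {in N, forall t, g t <= c} ->
  (above N g b)%:Z <= c - b.
Proof.
move=> injg le_bc gc; apply: (card_interval (g := g)) => //.
  by move=> s t; rewrite !inE => /andP[sN _] /andP[tN _]; apply: injg.
by move=> t; rewrite inE => /andP[tN ->]; rewrite gc.
Qed.

Lemma above_lipschitz (T : finType) (N : {set T}) (g : T -> int) (b c : int) :
  {in N &, injective g} -> b <= c ->
  (above N g b)%:Z <= c - b + (above N g c)%:Z.
Proof.
move=> injg le_bc; rewrite /above.
rewrite -(cardsID [set t | g t <= c] [set t in N | b < g t]) PoszD.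
apply: lerD.
  apply: (card_interval (g := g)) => //.
    by move=> s t; rewrite !inE => /andP[/andP[sN _] _] /andP[/andP[tN _] _]; apply: injg.
  by move=> t; rewrite !inE => /andP[/andP[_ ->] ->].
rewrite lez_nat; apply: subset_leq_card; apply/fintype.subsetP => t; rewrite !inE.
by rewrite -ltNge => /andP[-> /andP[-> _]].
Qed.

Lemma exists_max (T : finType) (N : {set T}) (g : T -> int) (t0 : T) :
  t0 \in N -> exists2 t, t \in N & {in N, forall s, g s <= g t}.
Proof.
move=> t0N; case: (@arg_maxP _ _ _ t0 (mem N) g t0N) => t tN h.
by exists t.
Qed.

Definition staircase (T : finType) (N : {set T}) (x y : T -> int) : Prop :=
  {in N &, forall s t, s != t ->
     x s < x t /\ y t < y s \/ x t < x s /\ y s < y t}.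

Lemma staircase_sym (T : finType) (N : {set T}) (x y : T -> int) :
  staircase N x y -> staircase N y x.
Proof.
move=> st s t sN tN nst.
by case: (st s t sN tN nst) => -[h1 h2]; [right|left].
Qed.

Lemma staircase_inj (T : finType) (N : {set T}) (x y : T -> int) :
  staircase N x y -> {in N &, injective x}.
Proof.
move=> st s t sN tN e; apply/eqP; apply: contraT => nst.
by case: (st s t sN tN nst) => -[]; rewrite e ltxx.
Qed.

Lemma staircase_above (T : finType) (N : {set T}) (x y : T -> int) (b : T) :
  staircase N x y -> b \in N -> above N (fun t => - y t) (- y b) = above N x (x b).
Proof.
move=> st bN; apply: eq_card => t; rewrite !inE.
case: (boolP (t \in N)) => //= tN; case: (eqVneq t b) => [->|nt].
  by rewrite !ltxx.
by case: (st t b tN bN nt) => -[h1 h2]; lia.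
Qed.

Lemma staircase_card (T : finType) (N : {set T}) (x y : T -> int) (b : T) :
  staircase N x y -> b \in N ->
  #|N| = (above N x (x b) + above N y (y b)).+1.
Proof.
move=> st bN; rewrite (cardsD1 b) bN add1n; congr _.+1.
rewrite -(cardsID [set t | x b < x t] (N :\ b)).
congr (_ + _)%N; apply: eq_card => t; rewrite !inE.
  case: (eqVneq t b) => [->|] //=; first by rewrite ltxx andbF.
case: (eqVneq t b) => [->|nt] //=; first by rewrite !ltxx !andbF.
case: (boolP (t \in N)) => [tN|]; rewrite ?andbF //=.
by case: (st t b tN bN nt) => -[h1 h2]; lia.
Qed.

Definition noncrossing (k : nat) (T : finType) (D : {set T}) (x y : T -> int) : Prop :=
  {in D &, forall s t, k%:Z <= x s - x t -> k%:Z <= y t - y s -> False}.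

(** The two ends of a staircase differ by at least [#|N| - 1] in both coordinates, in opposite
    directions. *)
Lemma staircase_le (k : nat) (T : finType) (N : {set T}) (x y : T -> int) :
  staircase N x y -> noncrossing k N x y -> (#|N| <= k)%N.
Proof.
move=> st nc; case: (posnP #|N|) => [->//|/card_gt0P[t0 t0N]].
have injx := staircase_inj st; have injy := staircase_inj (staircase_sym st).
have [b bN bmax] := exists_max y t0N; have [c cN cmax] := exists_max x t0N.
have ey : above N y (y b) = 0%N.
  apply/eqP; rewrite cards_eq0; apply/eqP/setP => t; rewrite !inE.
  by apply/negP => /andP[tN]; rewrite ltNge bmax.
have eN := staircase_card st bN; rewrite ey addn0 in eN.
have hx : (above N x (x b))%:Z <= x c - x b by apply: above_max => //; apply: cmax.
have hy : (above N x (x b))%:Z <= - y c - - y b.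
  rewrite -(staircase_above st bN); apply: above_max => [s t sN tN /oppr_inj|/=|t tN].
  - exact: injy.
  - by rewrite lerN2 bmax.
  rewrite lerN2; case: (eqVneq t c) => [->//|nt].
  by case: (st t c tN cN nt) => -[h1 h2]; have := cmax t tN; lia.
rewrite leqNgt; apply/negP => lt; apply: (nc c b cN bN); lia.
Qed.

(** * Potentials and their levels *)

(* [v] can replace the third coordinate of a k-crossing-free antichain whose
   first two coordinates are [x] and [y] *)
Definition potential (k : nat) (T : finType) (D : {set T}) (x y : T -> int)
    (v : T -> nat) : Prop :=
  {in D &, forall s t, s != t -> x s <= x t -> y s <= y t -> (v t < v s)%N} /\
  {in D &, forall s t, k%:Z <= x s - x t \/ k%:Z <= y s - y t -> (v t < v s + k)%N}.

(** This is the tightness that minimality of a potential yields. It concerns [t] only through its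
    level: [s] and [u] may lie anywhere on the two levels. *)
Definition linked (k : nat) (T : finType) (D : {set T}) (x y : T -> int)
    (v : T -> nat) : Prop :=
  {in D, forall t, (k <= v t)%N -> exists s u, [/\ s \in D, u \in D,
    v s = v t, (v u + k = v t)%N &
    [/\ x s <= x u, y s <= y u & k%:Z <= (x u - x s) + (y u - y s)]]}.

Lemma level_staircase (k : nat) (T : finType) (D : {set T}) (x y : T -> int)
    (v : T -> nat) (n : nat) :
  potential k D x y v -> staircase [set t in D | v t == n] x y.
Proof.
move=> [mono _] s t; rewrite !inE => /andP[sD /eqP es] /andP[tD /eqP et] nst.
have H1 h1 h2 := mono s t sD tD nst h1 h2.
have H2 h1 h2 := mono t s tD sD (_ : t != s) h1 h2.
rewrite eq_sym nst in H2; rewrite es et ltnn in H1 H2.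
have {}H2 := H2 isT.
case: (ltP (x s) (x t)) => hx; case: (ltP (y t) (y s)) => hy; [by left| | |].
- by case: (H1 (ltW hx) hy).
- by case: (H2 hx (ltW hy)).
- case: (ltP (x t) (x s)) => hx'; last by case: (H1 hx' hy).
  by right; split => //; rewrite ltNge; apply/negP => hy'; case: (H2 hx hy').
Qed.

Lemma class_gap (k m n : nat) : (m < n + k)%N -> m = n %[mod k] -> (m <= n)%N.
Proof.
move=> lt e; rewrite leqNgt; apply/negP => lt'.
have em := divn_eq m k; have en := divn_eq n k; rewrite e in em.
move: (m %/ k)%N (n %/ k)%N (n %% k)%N em en => p q r em en.
have : (q * k < p * k < q.+1 * k)%N by rewrite mulSn; lia.
case: (posnP k) => [->|k0]; first by rewrite !muln0.
by rewrite !ltn_pmul2r //; lia.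
Qed.

(* [m] counts the levels n, n - k, n - 2k, ... together.  The second conjunct is
   the invariant of the induction; it keeps track of how far [b] is from the
   right- and topmost members of the levels up to n. *)
Lemma level_class_le (k : nat) (T : finType) (D : {set T}) (x y : T -> int)
    (v : T -> nat) (n : nat) (b : T) : (0 < k)%N ->
  noncrossing k D x y -> potential k D x y v -> linked k D x y v ->
  b \in D -> v b = n ->
  let m := #|[set t in D | (v t <= n)%N && (v t == n %[mod k])]| in
  (m <= k)%N /\
  exists u w, [/\ u \in D, w \in D, (v u <= n)%N, (v w <= n)%N &
    m%:Z + x b + y b <= x u + y w + 1].
Proof.
move=> k0 nc pot link bD; elim/ltn_ind: n b bD => n IH b bD vb m.
pose N := [set t in D | v t == n].
have bN : b \in N by rewrite inE bD vb /=.
have st : staircase N x y := level_staircase pot.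
have st' := staircase_sym st.
have injx := staircase_inj st; have injy := staircase_inj st'.
have injNx : {in N &, injective (fun t => - x t)}.
  by move=> s t sN tN /oppr_inj; apply: injx.
have injNy : {in N &, injective (fun t => - y t)}.
  by move=> s t sN tN /oppr_inj; apply: injy.
have [right rN rmax] := exists_max x bN.
have [top tN tmax] := exists_max y bN.
have [left lN lmax] := exists_max (fun t => - x t) bN.
have [bot oN omax] := exists_max (fun t => - y t) bN.
have NP t : t \in N -> t \in D /\ v t = n by rewrite inE => /andP[? /eqP].
have [[rD vr] [tD vt]] := (NP _ rN, NP _ tN).
have [[lD vl] [oD vo]] := (NP _ lN, NP _ oN).
case: (ltnP n k) => [lt_nk|le_kn].
  have -> : m = #|N|.
    apply: eq_card => t; rewrite !inE; case: (t \in D) => //=.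
    apply/andP/eqP => [[h /eqP]|->]; last by split.
    by rewrite !modn_small // (leq_ltn_trans h).
  split.
    by apply: (staircase_le st) => s t /NP[sD _] /NP[tD' _]; apply: nc.
  exists right, top; split; rewrite ?vr ?vt //.
  have := above_max injx (rmax b bN) rmax.
  have := above_max injy (tmax b bN) tmax.
  by rewrite (staircase_card st bN); clear; lia.
(* The induction hypothesis is applied at [a], the upper end of the link, on level n - k. *)
have [||s [a [sD aD vs va [xsa ysa gap]]]] := link b; rewrite ?vb //.
rewrite vb in vs va.
have sN : s \in N by rewrite inE sD vs /=.
have lt_an : (v a < n)%N by rewrite -va -{1}[v a]addn0 ltn_add2l.
have [] := IH (v a) lt_an a aD erefl.
set m' := #|_| => _ [u [w [uD wD vu vw hm']]].
have em : m = (m' + #|N|)%N.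
  rewrite /m -(cardsID N) addnC; congr (_ + _)%N; apply: eq_card => t; rewrite !inE.
    case: (t \in D) => //=; rewrite -va modnDr.
    case: (eqVneq (v t) (v a + k)%N) => [->|nv]; first by rewrite /= leqNgt -{1}[v a]addn0 ltn_add2l k0.
    rewrite /=; apply/andP/andP => -[h1 h2]; split=> //.
      by apply: (class_gap (k := k)); [rewrite ltn_neqAle nv h1 | apply/eqP].
    by apply: leq_trans h1 _; apply: leq_addr.
  case: (t \in D) => //=; apply/andP/eqP => [[_ /eqP]//|->].
  by rewrite leqnn eqxx.
(* Since [u] and [w] have level at most n - k, the second clause of [potential] keeps level n less
   than k to the left of [u] and less than k below [w]. *)
have hl : x u - x left < k%:Z.
  rewrite ltNge; apply/negP => h.
  have := pot.2 u left uD lD (or_introl h).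
  by rewrite vl -va ltn_add2r ltnNge vu.
have ho : y w - y bot < k%:Z.
  rewrite ltNge; apply/negP => h.
  have := pot.2 w bot wD oD (or_intror h).
  by rewrite vo -va ltn_add2r ltnNge vw.
(* The members of [N] above [s] are those to its left, so there are at most [x s - x left] of them;
   likewise at most [y s - y bot] lie to its right. *)
have sl := above_max injNx (lmax s sN) lmax.
have so := above_max injNy (omax s sN) omax.
rewrite (staircase_above st' sN) in sl; rewrite (staircase_above st sN) in so.
have eN := staircase_card st sN; have eNb := staircase_card st bN.
split.
  by move: gap hm' hl ho sl so; rewrite em eN; clear; lia.
(* When [s] is not to the right of [b], the members right of [b] are paid for by moving from [u] to
   [right], and those above [b] by the link at [s]; [w] is kept. The other case is symmetric. *)
case: (leP (x s) (x b)) => [le_sb|/ltW le_bs].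
  exists right, w; split; rewrite ?vr //; first exact: leq_trans vw (ltnW lt_an).
  have hr := above_max injx (rmax b bN) rmax.
  have le_y : y b <= y s.
    case: (eqVneq s b) => [->//|nsb].
    by case: (st s b sN bN nsb) => -[h1 /ltW h2] //; move: le_sb; rewrite leNgt h1.
  move: gap hm' hl sl hr (above_lipschitz injy le_y); rewrite em eNb; clear; lia.
exists u, top; split; rewrite ?vt //; first exact: leq_trans vu (ltnW lt_an).
have hr := above_max injy (tmax b bN) tmax.
move: gap hm' ho so hr (above_lipschitz injx le_bs); rewrite em eNb; clear; lia.
Qed.

(* A potential with minimal sum is linked: if no pair links level n to level
   n - k, then the elements of level at least n, together with those reached
   from level n by going up, can all be lowered by one. *)
Lemma exists_linked (k : nat) (T : finType) (D : {set T}) (x y : T -> int)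
    (v : T -> nat) : (0 < k)%N -> potential k D x y v ->
  exists2 v', potential k D x y v' & linked k D x y v'.
Proof.
move=> k0; have [m] := ubnP (\sum_(t in D) v t).
elim: m v => // m IH v lt_m pot.
pose link t s u := [&& v s == v t, (v u + k == v t)%N, x s <= x u, y s <= y u
  & k%:Z <= (x u - x s) + (y u - y s)].
have [L|] := boolP [forall t in D, (k <= v t)%N ==>
    [exists s in D, exists u in D, link t s u]].
  exists v => // t tD kt.
  move/forall_inP/(_ t tD)/implyP/(_ kt): L.
  move=> /exists_inP[s sD /exists_inP[u uD /and5P[/eqP e1 /eqP e2 h1 h2 h3]]].
  by exists s, u.
case/forall_inPn=> t0 t0D; rewrite negb_imply => /andP[kn nolink].
set n := v t0 in kn.
(* Each unit by which [v] drops below n must be matched by a unit of l^1-distance climbed from level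
   n. A near member of level n - k would therefore complete a link. *)
pose near t := [exists s in D, [&& v s == n, x s <= x t, y s <= y t
  & n%:Z - (v t)%:Z <= (x t - x s) + (y t - y s)]].
pose W t := (n <= v t)%N || ((n < v t + k)%N && near t).
pose v' t := if W t then (v t).-1 else v t.
have Wgt0 t : W t -> (0 < v t)%N.
  by case/orP => [h|/andP[h _]]; move: kn h k0; clear; lia.
have nearN t : t \in D -> v t = n -> near t.
  move=> tD e; apply/exists_inP; exists t => //.
  by rewrite e eqxx !lexx !subrr.
have Wnear t : t \in D -> W t -> (v t <= n)%N -> near t.
  move=> tD /orP[h1 h2|/andP[]//]; apply: nearN => //.
  by apply/eqP; rewrite eqn_leq h1 h2.
(* Lowering [W] can break strict monotonicity only at a drop of exactly one from inside [W] to
   outside. *)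
have Wup s t : s \in D -> t \in D -> s != t -> x s <= x t -> y s <= y t ->
    W s -> v s = (v t).+1 -> W t.
  move=> sD tD nst hx hy Ws e; case: (leqP n (v t)) => [h|lt_n]; first by rewrite /W h.
  have le_sn : (v s <= n)%N by rewrite e.
  have /exists_inP[r rD /and4P[er h1 h2 h3]] := Wnear s sD Ws le_sn.
  rewrite /W; apply/orP; right.
  have L1 : 1 <= (x t - x s) + (y t - y s).
    rewrite leNgt; apply/negP => h.
    have ex : x t <= x s by move: hx hy h; clear; lia.
    have ey : y t <= y s by move: hx hy h; clear; lia.
    have := pot.1 t s tD sD; rewrite eq_sym => /(_ nst ex ey).
    by rewrite e ltnNge leqnSn.
  have nt : near t.
    apply/exists_inP; exists r => //; rewrite er (le_trans h1 hx) (le_trans h2 hy) /=.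
    by move: h3 L1; rewrite e; clear; lia.
  rewrite nt andbT ltn_neqAle; apply/andP; split.
    apply/negP => /eqP en; case/negP: nolink; apply/exists_inP; exists r => //.
    apply/exists_inP; exists t => //; rewrite /link er -en eqxx.
    rewrite (le_trans h1 hx) (le_trans h2 hy) /=.
    by move: h3 L1; rewrite e en; clear; lia.
  case/orP: Ws => [h|/andP[h _]]; move: h; rewrite e; move: k0; clear; lia.
apply: (IH v').
  rewrite ltnS in lt_m; apply: leq_trans lt_m.
  rewrite (bigD1 t0) //= [ltnRHS](bigD1 t0) //= -addSn leq_add //.
    have Wt0 : W t0 by rewrite /W leqnn.
    by rewrite /v' Wt0 prednK // Wgt0.
  by apply: leq_sum => t _; rewrite /v'; case: ifP => // _; apply: leq_pred.
split=> s t sD tD.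
  move=> nst hx hy; have lt := pot.1 s t sD tD nst hx hy.
  rewrite /v'; case: (boolP (W s)) => Ws; case: (boolP (W t)) => Wt //.
  - by move: (Wgt0 t Wt) lt; clear; lia.
  - have ne : v s <> (v t).+1 by move=> e; case/negP: Wt; apply: (Wup s t).
    by move: ne lt; clear; lia.
  - by move: lt; clear; lia.
move=> far; have lt := pot.2 s t sD tD far.
rewrite /v'; case: (boolP (W s)) => Ws; case: (boolP (W t)) => Wt //.
- by move: (Wgt0 s Ws) (Wgt0 t Wt) lt; clear; lia.
(* Every [s] in [W] satisfies [n < v s + k], so equality here would put [t] at level at least n,
   hence in [W]. *)
- have ne : (v t).+1 <> (v s + k)%N.
    move=> e; case/negP: Wt; rewrite /W; apply/orP; left.
    by case/orP: Ws => [h|/andP[h _]]; move: h e k0; clear; lia.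
  by move: ne lt (Wgt0 s Ws); clear; lia.
- by move: lt; clear; lia.
Qed.

(** * Dimensions one, two and three *)

Lemma at_most_1 (k : nat) : (0 < k)%N -> at_most k 'I_1 1.
Proof.
move=> k0 T D a [anti _]; apply/card_le1_eqP => s t sD tD.
apply/eqP; apply: contraT => nst.
have nts := nst; rewrite eq_sym in nts.
have [i] := anti s t sD tD nts; have [j] := anti t s tD sD nst.
by rewrite (ord1 i) (ord1 j) => h1 h2; have := lt_trans h1 h2; rewrite ltxx.
Qed.

Lemma at_most_2 (k : nat) : at_most k 'I_2 k.
Proof.
move=> T D a [anti nocr].
pose o0 : 'I_2 := ord0; pose o1 : 'I_2 := ord_max.
have oP (i : 'I_2) : i = o0 \/ i = o1.
  by case: i => [[|[|//]] h]; [left|right]; apply: val_inj.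
apply: (staircase_le (x := fun t => a t o0) (y := fun t => a t o1)).
  move=> s t sD tD nst.
  have [i] := anti s t sD tD nst.
  have nts := nst; rewrite eq_sym in nts.
  have [j] := anti t s tD sD nts.
  case: (oP i) => ->; case: (oP j) => -> h1 h2; [|by right|by left|].
    by have := lt_trans h1 h2; rewrite ltxx.
  by have := lt_trans h1 h2; rewrite ltxx.
by move=> s t sD tD; apply: nocr.
Qed.

Lemma at_most_3 (k : nat) : (0 < k)%N -> at_most k 'I_3 (k * k).
Proof.
move=> k0 T D a [anti nocr].
pose o0 : 'I_3 := ord0; pose o1 : 'I_3 := inord 1; pose o2 : 'I_3 := ord_max.
have oP (i : 'I_3) : [\/ i = o0, i = o1 | i = o2].
  case: i => [[|[|[|//]]] h]; [apply: Or31|apply: Or32|apply: Or33]; apply: val_inj => //.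
  by rewrite /= inordK.
pose x t := a t o0; pose y t := a t o1; pose z t := a t o2.
have [Z zZ] : exists Z : int, forall t, 0 <= z t + Z.
  exists (\sum_t `|z t|) => t; rewrite (bigD1 t) //= addrA addr_ge0 ?sumr_ge0 //.
  by move: (z t); clear; lia.
have nc : noncrossing k D x y by move=> s t sD tD; apply: nocr.
have pot0 : potential k D x y (fun t => absz (z t + Z)).
  split=> s t sD tD.
    move=> nst hx hy; have [i] := anti s t sD tD nst.
    case: (oP i) => -> h; [by move: hx; rewrite /x leNgt h|by move: hy; rewrite /y leNgt h|].
    by move: h (zZ s) (zZ t); rewrite -/(z s) -/(z t); clear; lia.
  move=> far; rewrite ltnNge; apply/negP => h.
  have hz : k%:Z <= z t - z s.
    by move: h (zZ s) (zZ t); clear; lia.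
  by case: far => far; [apply: (nocr s t o0 o2)|apply: (nocr s t o1 o2)].
have [v pot link] := exists_linked k0 pot0.
rewrite -[X in (X * _)%N]card_ord.
pose r t := Ordinal (ltn_pmod (v t) k0).
apply: (card_le_fibers (f := r)) => q.
have [->|[t0]] := set_0Vmem [set t in D | r t == q]; first by rewrite cards0.
(* With n the highest level in the residue class, the whole class lies in the levels n, n - k, n -
   2k, and so on. *)
move=> t0F; have [t tF tmax] := exists_max (fun t => (v t)%:Z) t0F.
move: (tF); rewrite inE => /andP[tD /eqP et].
have [+ _] := level_class_le k0 nc pot link tD erefl.
apply: leq_trans; apply: subset_leq_card; apply/fintype.subsetP => s sF.
have := tmax s sF; rewrite lez_nat; move: sF; rewrite !inE => /andP[-> /eqP es] ->.
by have /(congr1 val) /= -> := etrans es (esym et); rewrite eqxx.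
Qed.

(** * Upper bounds in every dimension *)

Lemma at_most_leq (k : nat) (I : Type) (m n : nat) :
  (m <= n)%N -> at_most k I m -> at_most k I n.
Proof. by move=> le hm T D a /hm/leq_trans; apply. Qed.

(** The formula solves the recursion of [at_most_succ] with the initial value k^2 = k^3 - k^2 (k -
    1) in dimension 3. *)
Lemma at_most_pow_sub (k w : nat) : (0 < k)%N -> (3 <= w)%N ->
  exists2 m, at_most k 'I_w m &
    m%:Z = k%:Z ^+ w - k%:Z ^+ 2 * (k%:Z - 1) ^+ (w - 2).
Proof.
move=> k0 w3; have [n ->] : exists n, w = n.+3 by exists (w - 3)%N; lia.
have -> : (n.+3 - 2 = n.+1)%N by [].
elim: n => [|n [m hm em]].
  exists (k * k)%N; first exact: at_most_3.
  by rewrite PoszM; ring.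
exists (k ^ n.+3 + k.-1 * m)%N.
  by have := at_most_succ k0 hm; rewrite addn1.
rewrite PoszD PoszM em -natz natrX natz.
have -> : k.-1%:Z = k%:Z - 1 by rewrite -subn1 subzn.
by rewrite !exprS; ring.
Qed.

Lemma at_most_triples (k q : nat) : (0 < k)%N ->
  at_most k 'I_(3 * q.+1) (q.+1 * k ^ (3 * q + 2)).
Proof.
move=> k0; elim: q => [|q IH].
  by rewrite muln1 mul1n; apply: at_most_3.
have -> : (3 * q.+2 = 3 * q.+1 + 3)%N by lia.
apply: at_most_leq (at_most_add k0 IH (at_most_3 k0)).
have -> : (3 * q.+1 = 3 * q + 2 + 1)%N by lia.
by rewrite !expnD; move: (k ^ (3 * q))%N => p; nia.
Qed.

(** Each block of three coordinates contributes k^(w-1), and so does a remaining block of one or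
    two. The condition on [c] says that c is at most the ceiling of w/3. *)
Lemma at_most_ceil (k w : nat) : (0 < k)%N -> (3 <= w)%N ->
  exists2 c, at_most k 'I_w (c * k ^ (w - 1)) & (3 * (c - 1) < w)%N.
Proof.
move=> k0 w3; have [q [r [lt_r ->]]] : exists q r, (r < 3)%N /\ w = (3 * q.+1 + r)%N.
  by exists (w %/ 3).-1, (w %% 3)%N; rewrite ltn_mod; split => //; lia.
have hq := at_most_triples (q := q) k0.
case: r lt_r => [|[|[|//]]] _.
- exists q.+1; last by lia.
  by have -> : (3 * q.+1 + 0 - 1 = 3 * q + 2)%N by [lia]; rewrite addn0.
- exists q.+2; last by lia.
  apply: at_most_leq (at_most_add k0 hq (at_most_1 k0)).
  have -> : (3 * q.+1 + 1 - 1 = 3 * q + 2 + 1)%N by lia.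
  have -> : (3 * q.+1 = 3 * q + 2 + 1)%N by lia.
  by rewrite !expnD; move: (k ^ (3 * q))%N => p; nia.
- exists q.+2; last by lia.
  apply: at_most_leq (at_most_add k0 hq (at_most_2 (k := k))).
  have -> : (3 * q.+1 + 2 - 1 = 3 * q + 2 + 2)%N by lia.
  have -> : (3 * q.+1 = 3 * q + 2 + 1)%N by lia.
  by rewrite !expnD; move: (k ^ (3 * q))%N => p; nia.
Qed.

(** * From indexed families to arbitrary sets of vectors *)

Lemma card_le_or_gt (U : Type) (F : set U) (m : nat) :
  (F #<= `I_m)%card \/ (`I_m.+1 #<= F)%card.
Proof.
have [/finite_setP[n Fn]|/infiniteP Fi] := pselect (finite_set F).
  case: (leqP n m) => h; [left|right].
    by rewrite (card_le_eql Fn) card_le_II.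
  by rewrite (card_le_eqr Fn) card_le_II.
by right; apply: card_le_trans Fi; apply: subset_card_le.
Qed.

(** A larger family, even an infinite one, contains m + 1 distinct vectors, and these already
    contradict the finite bound. *)
Lemma at_most_card_le (k w m : nat) (F : set 'rV[int]_w) :
  at_most k 'I_w m -> antichain F -> crossing_free k F -> (F #<= `I_m)%card.
Proof.
move=> hm anti nocr; have [//|/card_leP[f]] := card_le_or_gt F m.
pose g (s : 'I_m.+1) : 'rV[int]_w := val (f (ordII s)).
have gF s : F (g s) by apply: set_valP.
have ginj : injective g.
  move=> s t /val_inj e; apply: val_inj.
  have /(congr1 val) // : ordII s = ordII t.
  by apply: (@inj _ _ _ f) e; rewrite in_setT.
have := hm _ [set: 'I_m.+1]%SET (fun s i => g s 0 i).
rewrite cardsT card_ord ltnn => /(_ _)/wrap[]//; split.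
  move=> s t _ _ nst; have := anti (g s) (g t) (gF s) (gF t) (_ : g s <> g t).
  move=> /(_ _)/wrap[]; first by move/ginj => e; rewrite e eqxx in nst.
  move=> /existsNP[i /negP]; rewrite -ltNge; by exists i.
by move=> s t i j _ _ h1 h2; apply: (nocr (g s) (g t)) => //; exists i, j.
Qed.

(** * The zero-sum family for the lower bound *)

Definition zero_sum_vec (k n : nat) (u : {ffun 'I_n -> 'I_k}) : 'rV[int]_n.+1 :=
  \row_j (if unlift ord0 j is Some i then (u i)%:Z else - \sum_i (u i)%:Z).

Lemma zero_sum_vec0 (k n : nat) (u : {ffun 'I_n -> 'I_k}) :
  zero_sum_vec u 0 ord0 = - \sum_i (u i)%:Z.
Proof. by rewrite mxE unlift_none. Qed.

Lemma zero_sum_vecS (k n : nat) (u : {ffun 'I_n -> 'I_k}) (i : 'I_n) :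
  zero_sum_vec u 0 (lift ord0 i) = (u i)%:Z.
Proof. by rewrite mxE liftK. Qed.

Lemma zero_sum_vec_inj (k n : nat) : injective (@zero_sum_vec k n).
Proof.
move=> u v e; apply/ffunP => i; apply: val_inj.
by have := zero_sum_vecS u i; rewrite e zero_sum_vecS => -[].
Qed.

Lemma zero_sum_vec_le (k n : nat) (u v : {ffun 'I_n -> 'I_k}) :
  vec_le (zero_sum_vec u) (zero_sum_vec v) -> u = v.
Proof.
move=> le; have leS i : 0 <= (v i)%:Z - (u i)%:Z :> int.
  by have := le (lift ord0 i); rewrite !zero_sum_vecS subr_ge0.
have le0 := le ord0; rewrite !zero_sum_vec0 lerN2 -subr_le0 -sumrB in le0.
have /eqP : \sum_i ((v i)%:Z - (u i)%:Z) = 0 :> int.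
  by apply/eqP; rewrite eq_le le0 sumr_ge0.
rewrite psumr_eq0 // => /allP h; apply/ffunP => i; apply: val_inj.
by have := h i (mem_index_enum i); rewrite /= subr_eq0 => /eqP [].
Qed.

(** A crossing needs two different coordinates. One of them is not the first, and there entries in
    [0, k-1] cannot differ by k. *)
Lemma exists_large_family (k n : nat) : (0 < k)%N -> exists F : set 'rV[int]_n.+1,
  [/\ antichain F, crossing_free k F & (F #= `I_(k ^ n))%card].
Proof.
move=> k0; pose g (m : 'I_#|{ffun 'I_n -> 'I_k}|) := zero_sum_vec (enum_val m).
exists (g @` [set: 'I_#|{ffun 'I_n -> 'I_k}|])%classic; split.
- by move=> _ _ [s _ <-] [t _ <-] nst /zero_sum_vec_le e; apply: nst; rewrite /g e.
- move=> _ _ [s _ <-] [t _ <-] [i [j]]; rewrite /g.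
  move: (enum_val s) (enum_val t) => u v.
  have [i'|] := unliftP ord0 i => -> [].
    rewrite !zero_sum_vecS => h1 _; move: h1 (ltn_ord (u i')).
    by move: (nat_of_ord (u i')) (nat_of_ord (v i')); clear; lia.
  have [j'|] := unliftP ord0 j => ->.
    rewrite !zero_sum_vecS => _ h; move: h (ltn_ord (v j')).
    by move: (nat_of_ord (u j')) (nat_of_ord (v j')); clear; lia.
  by move: k0; clear; lia.
rewrite -[k in (k ^ _)%N]card_ord -[n in (_ ^ n)%N]card_ord -card_ffun.
rewrite (card_eql (inj_card_eq _)) ?[(_ #= `I__)%card]card_eq_sym ?card_II //.
by move=> s t _ _ /zero_sum_vec_inj/enum_val_inj.
Qed.

(** * Existence of the maximum and its bounds *)

Theorem theorem3 (w k : nat) (hw : (4 <= w)%N) (hk : (1 <= k)%N) :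
  exists f : nat,
    is_f k w f /\
    k%:Z ^+ (w - 1) <= f%:Z
      <= Num.min (k%:Z ^+ w - k%:Z ^+ 2 * (k%:Z - 1) ^+ (w - 2))
                 (Num.ceil (w%:R / 3 : rat) * k%:Z ^+ (w - 1)).
Proof.
have w3 : (3 <= w)%N := ltnW hw.
have [m1 h1 e1] := at_most_pow_sub hk w3.
have [c h2 e2] := at_most_ceil hk w3.
pose P n := `[< exists F : set 'rV[int]_w,
  [/\ antichain F, crossing_free k F & (F #= `I_n)%card] >].
have Ple m n : at_most k 'I_w m -> P n -> (n <= m)%N.
  move=> hm /asboolP[F [anti nocr Fn]].
  by rewrite -card_le_II -(card_le_eql Fn); apply: (at_most_card_le hm).
have Plow : P (k ^ (w - 1))%N.
  apply/asboolP; case: w hw {w3 h1 e1 h2 e2 P Ple} => // n _.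
  by rewrite subn1; apply: exists_large_family.
have exP : exists n, P n by exists (k ^ (w - 1))%N.
(* The maximum is taken over sizes of finite families; [h1] bounds these sizes and later also
   excludes infinite families. *)
have [f Pf fmax] := ex_maxnP exP (fun n => @Ple m1 n h1).
exists f; split; first split.
- by move/asboolP: Pf.
- move=> F anti nocr; have Fm := at_most_card_le h1 anti nocr.
  have /finite_setP[n Fn] : finite_set F by apply/finite_set_leP; exists m1.
  rewrite (card_le_eql Fn) card_le_II; apply: fmax.
  by apply/asboolP; exists F.
have powz n : k%:Z ^+ n = (k ^ n)%:Z by rewrite -[RHS]natz natrX natz.
rewrite powz lez_nat fmax //= le_min -e1 lez_nat (Ple _ _ h1 Pf) /=.
have lec : c%:Z <= Num.ceil (w%:R / 3 : rat).
  have : c%:Z - 1 < Num.ceil (w%:R / 3 : rat); last by lia.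
  rewrite ceil_gt_int ltr_pdivlMr // -[3]/(3%:~R) -[w%:R]/(w%:~R) -intrM ltr_int.
  by move: e2; clear; lia.
apply: le_trans (_ : (c * k ^ (w - 1))%N%:Z <= _).
  by rewrite lez_nat; apply: Ple Pf.
by rewrite PoszM ler_wpM2r.
Qed.
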